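(* Let $\mathcal{H}$ be a complex separable Hilbert space and let $T\in\mathcal{B}(\mathcal{H})$ be a power-bounded operator. Then $T$ is of class $C_{\cdot 1}$ if and only if $\overline{\mathcal{M}(T)}=\mathcal{H}$.
   Context: $\mathcal{B}(\mathcal{H})$ is the space of bounded linear operators on $\mathcal{H}$. An operator $T\in\mathcal{B}(\mathcal{H})$ is power-bounded if $\sup_{n\ge 1}\|T^n\|<\infty$. An operator $A\in\mathcal{B}(\mathcal{H})$ is of class $C_{1\cdot}$ if $\liminf_{n\to\infty}\|A^n x\|>0$ for every nonzero $x\in\mathcal{H}$; it is of class $C_{\cdot 1}$ if its adjoint $A^*$ is of class $C_{1\cdot}$. With $\mathbb{N}=\{0,1,2,\dots\}$, $\mathcal{M}(T)$ denotes the set of all $x\in\mathcal{H}$ for which there exists a bounded sequence $\{x_n\}_{n\in\mathbb{N}}\subset\mathcal{H}$ with $x_0=x$ and $Tx_{n+1}=x_n$ for all $n\in\mathbb{N}$. The bar denotes norm closure. *)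

(* Defs.v *)
From mathcomp Require Import all_boot all_order all_algebra.
From mathcomp Require Import sesquilinear complex.
From mathcomp Require Import all_classical all_reals all_analysis.

Set Implicit Arguments.
Unset Strict Implicit.
Unset Printing Implicit Defensive.

Import Order.TTheory GRing.Theory Num.Theory.
Import numFieldNormedType.Exports.

Local Open Scope classical_set_scope.
Local Open Scope ring_scope.

(* A complex Hilbert space is rendered as a complete normed module over R[i]
   whose norm is the one induced by a positive definite Hermitian form
   (linear in its first argument, conjugate-linear in the second). *)
Definition norm_induced_by (R : realType) (H : completeNormedModType R[i])
    (dot : {dot H for @Num.conj R[i]}) : Prop :=
  forall x : H, `|x| = sqrtC (dot x x).

Definition separable (X : topologicalType) : Prop :=
  exists D : set X, countable D /\ dense D.

(* In a normed module over R[i] the norm `|x| is an element of R[i] (with zero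
   imaginary part); [rnorm x] is the same number in R, so that suprema and
   inferior limits can be taken in \bar R. *)
Definition rnorm (R : realType) (H : normedModType R[i]) (x : H) : R :=
  complex.Re `|x|.

Definition opnorm (R : realType) (H : normedModType R[i]) (A : H -> H) :
    \bar R :=
  ereal_sup [set (rnorm (A x))%:E | x in [set x : H | rnorm x <= 1]].

Definition power_bounded (R : realType) (H : normedModType R[i])
    (A : H -> H) : Prop :=
  (ereal_sup [set opnorm (iter n A) | n in [set n : nat | (1 <= n)%N]]
     < +oo)%E.

(* The adjoint: for A bounded and linear, the Riesz representation theorem gives
   for each x exactly one z with <A y, x> = <y, z> for all y; the default value
   0 of [xget] is then never used. *)
Definition adjoint (R : realType) (H : completeNormedModType R[i])
    (dot : {dot H for @Num.conj R[i]}) (A : H -> H) : H -> H :=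
  fun x => xget 0 [set z : H | forall y : H, dot (A y) x = dot y z].

Definition class_C1_ (R : realType) (H : normedModType R[i])
    (A : H -> H) : Prop :=
  forall x : H, x != 0 ->
    (0 < limn_einf (fun n => (rnorm (iter n A x))%:E))%E.

Definition class_C_1 (R : realType) (H : completeNormedModType R[i])
    (dot : {dot H for @Num.conj R[i]}) (A : H -> H) : Prop :=
  class_C1_ (adjoint dot A).

Definition bounded_backward_set (R : realType) (H : normedModType R[i])
    (A : H -> H) : set H :=
  [set x : H | exists u : nat -> H,
    [/\ bounded_fun u, u 0%N = x & forall n, A (u n.+1) = u n]].

(* Main.v *)
Require Import Defs.
From mathcomp Require Import all_boot all_order all_algebra.
From mathcomp Require Import sesquilinear complex.
From mathcomp Require Import all_classical all_reals all_analysis.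
From mathcomp Require Import lra ring.

Set Implicit Arguments.
Unset Strict Implicit.
Unset Printing Implicit Defensive.

Import Order.TTheory GRing.Theory Num.Theory.
Import numFieldNormedType.Exports.

Local Open Scope classical_set_scope.
Local Open Scope ring_scope.

(** Write S for the adjoint of T and M for the set of starting points of
    bounded backward orbits of T; M is a linear subspace.

    If M is dense, let x be a vector whose forward orbit S^n x comes arbitrarily
    close to 0. For y in M with bounded backward orbit u one has
    <y, x> = <T^n (u n), x> = <u n, S^n x>, which is as small as desired
    ([backward_set_rdot_small]). So x is orthogonal to M, hence x = 0.

    Conversely, let T be of class C_.1. A Banach limit L turns the bounded
    sequences <S^n z, S^n x> into a bounded form in (z, x), and the Riesz theorem
    represents it by an operator Q, <z, Q x> = L(<S^n z, S^n x>)
    ([asymptotic_limit_exists]). Invariance of L under the shift gives T Q S = Q,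
    so that Q x, Q (S x), Q (S^2 x), ... is a bounded backward orbit of T and
    Q x lies in M ([asymptotic_limit_backward]). A nonzero x is not
    orthogonal to Q x, because <x, Q x> = L(|S^n x|^2) is positive: the norms
    |S^n x| are eventually bounded below. Thus no nonzero vector is orthogonal to
    M ([orthogonal_backward_set_eq0]), and the projection theorem gives
    density.

    Everything is carried out with the real inner product Re <x, y>: it induces
    the same norm and still separates vectors, and with it the forms to which L is
    applied are real-valued. *)

(** * Banach limits *)

Definition bounded_seq (R : realType) (u : nat -> R) : Prop :=
  exists M : R, forall n, `|u n| <= M.

(** L is a total function whose values on unbounded sequences are arbitrary, so
    each law is restricted to bounded sequences. *)
Record banach_limit (R : realType) (L : (nat -> R) -> R) : Prop := {
  blimD : forall u v, bounded_seq u -> bounded_seq v ->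
    L (fun n => u n + v n) = L u + L v;
  blimZ : forall a u, bounded_seq u -> L (fun n => a * u n) = a * L u;
  blim_shift : forall u, bounded_seq u -> L (fun n => u n.+1) = L u;
  blim_ge : forall c u, bounded_seq u -> (forall n, c <= u n) -> c <= L u }.

Definition cesaro (R : realType) (u : nat -> R) (N : nat) : R :=
  N.+1%:R^-1 * \sum_(i < N.+1) u i.

Lemma cesaro_ge (R : realType) (u : nat -> R) (c : R) (N : nat) :
  (forall n, c <= u n) -> c <= cesaro u N.
Proof.
move=> cu; rewrite /cesaro ler_pdivlMl ?ltr0n// mulr_natl.
rewrite -[X in c *+ X]card_ord -sumr_const; exact: ler_sum.
Qed.

Lemma cesaro_le (R : realType) (u : nat -> R) (c : R) (N : nat) :
  (forall n, u n <= c) -> cesaro u N <= c.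
Proof.
move=> cu; rewrite /cesaro ler_pdivrMl ?ltr0n// mulr_natl.
rewrite -[X in c *+ X]card_ord -sumr_const; exact: ler_sum.
Qed.

(** For any A, either the preimage of A or its complement is in the ultrafilter,
    so a proper extension of the image filter would contain two disjoint
    sets. *)
Lemma ultra_fmap (X Y : Type) (f : X -> Y) (F : set_system X) :
  UltraFilter F -> UltraFilter (f @ F).
Proof.
move=> UF; split; first exact: fmap_proper_filter.
move=> G GF fFG; apply/seteqP; split => // A GA.
have [//|FnA] := in_ultra_setVsetC (f @^-1` A) UF.
have /filter_ex[y []//] : G (A `&` ~` A) by apply: filterI => //; exact: fFG.
Qed.

(** The means of a bounded sequence stay in a compact interval. *)
Lemma cesaro_cvg_ultra (R : realType) (U : set_system nat)
    (UU : UltraFilter U) (u : nat -> R) :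
  bounded_seq u -> cvg (cesaro u N @[N --> U]).
Proof.
move=> [M uM].
have : compact `[- M, M] by exact: segment_compact.
rewrite compact_ultra => /(_ _ (ultra_fmap (cesaro u) UU))[].
  apply: (@filterE _ U) => N /=; rewrite in_itv/=; apply/andP; split.
    by apply: cesaro_ge => n; have := uM n; rewrite ler_norml => /andP[].
  by apply: cesaro_le => n; have := uM n; rewrite ler_norml => /andP[].
by move=> l [_ ul]; apply/cvg_ex; exists l.
Qed.

Lemma cesaro_shift (R : realType) (u : nat -> R) (N : nat) :
  cesaro (fun n => u n.+1) N = cesaro u N + (N.+1%:R^-1 * (u N.+1 - u 0%N)).
Proof.
rewrite /cesaro -mulrDr; congr (_ * _).
have : \sum_(i < N.+2) u i = u 0%N + \sum_(i < N.+1) u i.+1.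
  by rewrite big_ord_recl.
rewrite big_ord_recr/=.
lra.
Qed.

(** The limit of the Cesaro means along a free ultrafilter: the limit along an
    ultrafilter is linear and monotone, and taking means first makes it
    shift-invariant, since shifting the sequence changes the N-th mean by
    O(1/N). *)
Lemma banach_limit_exists (R : realType) :
  exists L : (nat -> R) -> R, banach_limit L.
Proof.
have [U [UU ooU]] := ultraFilterLemma eventually_filter.
have cv u := @cesaro_cvg_ultra R U UU u.
exists (fun u => lim (cesaro u N @[N --> U])); split.
- move=> u v bu bv; apply: cvg_lim => //.
  rewrite [X in X @ _](_ : _ = fun N => cesaro u N + cesaro v N).
    exact: cvgD (cv _ bu) (cv _ bv).
  by apply/funext => N; rewrite /cesaro big_split mulrDr.
- move=> a u bu; apply: cvg_lim => //.
  rewrite [X in X @ _](_ : _ = fun N => a * cesaro u N).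
    exact: cvgMr (cv _ bu).
  by apply/funext => N; rewrite /cesaro -mulr_sumr mulrCA.
- move=> u bu; apply: cvg_lim => //.
  rewrite (_ : cesaro _ = fun N => cesaro u N + (N.+1%:R^-1 * (u N.+1 - u 0%N))); last first.
    by apply/funext => N; exact: cesaro_shift.
  rewrite -[X in _ --> X]addr0; apply: cvgD; first exact: cv.
  apply: (cvg_trans (cvg_app _ ooU)).
  have [M uM] := bu.
  apply/norm_cvg0P.
  apply: (@squeeze_cvgr _ _ _ _ (fun=> 0) (fun N => N.+1%:R^-1 * (M + M))).
  + near=> N; rewrite normr_ge0/= normrM ger0_norm ?invr_ge0//.
    by rewrite ler_wpM2l ?invr_ge0// (le_trans (ler_normB _ _))// lerD.
  + exact: cvg_cst.
  + rewrite -[X in _ --> X](mul0r (M + M)); apply: cvgMl; exact: cvg_harmonic.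
- move=> c u bu cu; apply: limr_ge; first exact: cv.
  by apply: nearW => N; exact: cesaro_ge.
Unshelve. all: by end_near. Qed.

Lemma blim_norm_le (R : realType) (L : (nat -> R) -> R) (u : nat -> R) (M : R) :
  banach_limit L -> (forall n, `|u n| <= M) -> `|L u| <= M.
Proof.
move=> HL uM; have bu : bounded_seq u by exists M.
have uM' n : - M <= u n /\ u n <= M by have := uM n; rewrite ler_norml => /andP.
rewrite ler_norml (blim_ge HL bu) => [/=|n]; last exact: (uM' n).1.
have : - M <= L (fun n => -1 * u n).
  apply: (blim_ge HL) => [|n]; first by exists M => n; rewrite mulN1r normrN.
  by rewrite mulN1r lerN2 (uM' n).2.
by rewrite (blimZ HL)// mulN1r lerN2.
Qed.

(** * Positive inferior limits *)

Lemma limn_einf_gt0P (R : realType) (a : nat -> R) :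
  (0 < limn_einf (fun n => (a n)%:E))%E <->
  exists c N, 0 < c /\ forall n, (N <= n)%N -> c <= a n.
Proof.
rewrite limn_einf_lim (cvg_lim _ (@cvg_einfs_sup R _))//; split.
- move=> /ereal_sup_gt[_ [N _ <-]] aN.
  have le_a n : (N <= n)%N -> (einfs (fun n => (a n)%:E) N <= (a n)%:E)%E.
    by move=> Nn; apply: ereal_inf_lbound; exists n.
  move: aN le_a; case: (einfs _ N) => [c||] //.
    by rewrite lte_fin => c0 le_a; exists c, N; split => // n /le_a; rewrite lee_fin.
  by move=> _ /(_ N (leqnn N)); rewrite leye_eq.
- move=> [c [N [c0 ca]]]; apply: (@lt_le_trans _ _ c%:E); first by rewrite lte_fin.
  apply: (@le_trans _ _ (einfs (fun n => (a n)%:E) N)).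
    by apply: le_ereal_inf_tmp => _ [n /= Nn <-]; rewrite lee_fin ca.
  by apply: ereal_sup_ubound; exists N.
Qed.

(** * The norm as a real number *)

Section rnorm_theory.
Variables (R : realType) (H : normedModType R[i]).
Implicit Types (x y : H) (a : R).

Lemma rnormE x : `|x| = ((rnorm x)%:C)%C.
Proof. by rewrite /rnorm RRe_real// normr_real. Qed.

Lemma rnorm_ge0 x : 0 <= rnorm x.
Proof. by rewrite -ler0c -rnormE. Qed.

Lemma rnorm_eq0 x : rnorm x = 0 -> x = 0.
Proof. by move=> x0; apply/normr0_eq0; rewrite rnormE x0. Qed.

Lemma ler_rnormD x y : rnorm (x + y) <= rnorm x + rnorm y.
Proof. by rewrite -lecR rmorphD/= -!rnormE ler_normD. Qed.

Lemma rnormN x : rnorm (- x) = rnorm x.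
Proof. by rewrite /rnorm normrN. Qed.

Lemma rnormZ a x : rnorm (a%:C%C *: x) = `|a| * rnorm x.
Proof.
apply: complexI; rewrite rmorphM/= -!rnormE normrZ; congr (_ * _).
by rewrite normc_def/= expr0n/= addr0 sqrtr_sqr.
Qed.

Lemma closure_rnormP (V : set H) x :
  closure V x <-> forall e : R, 0 < e -> exists2 v, V v & rnorm (x - v) < e.
Proof.
split.
- move=> Vx e e0; have e0C : 0 < (e%:C)%C :> R[i] by rewrite ltcR.
  have [v [Vv]] := Vx _ (nbhsx_ballx x _ e0C).
  by rewrite -ball_normE/= rnormE ltcR => xv; exists v.
- move=> h B /nbhs_ballP[e /= e0 eB].
  have eE : e = (complex.Re e)%:C%C by rewrite RRe_real// gtr0_real.
  have [|v Vv xv] := h (complex.Re e); first by rewrite -ltcR -eE.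
  exists v; split => //; apply: eB; rewrite -ball_normE/= rnormE eE.
  by rewrite ltcR.
Qed.

End rnorm_theory.

Lemma rnorm_complete (R : realType) (H : completeNormedModType R[i]) (v : nat -> H) :
  (forall e : R, 0 < e -> exists N, forall m n, (N <= m)%N -> (N <= n)%N ->
     rnorm (v m - v n) < e) ->
  exists q : H, forall e : R, 0 < e -> exists N, forall n, (N <= n)%N ->
     rnorm (v n - q) < e.
Proof.
move=> cv.
have : cvg (v @ \oo).
  apply: cauchy_cvg; apply/cauchy_ballP => e e0.
  have eE : e = (complex.Re e)%:C%C by rewrite RRe_real// gtr0_real.
  have [|N vN] := cv (complex.Re e); first by rewrite -ltcR -eE.
  have NV : \forall n \near \oo, (v @` [set n | (N <= n)%N]) (v n).
    by exists N => // n Nn; exists n.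
  exists (v @` [set n | (N <= n)%N], v @` [set n | (N <= n)%N]) => //.
  move=> [_ _] /= [[m Nm <-] [n Nn <-]].
  by rewrite -ball_normE/= rnormE eE ltcR; exact: vN.
move=> /cvg_ex[q vq]; exists q => e e0.
have e0C : 0 < (e%:C)%C :> R[i] by rewrite ltcR.
have := vq _ (nbhsx_ballx q _ e0C).
move=> [N _ vN]; exists N => n Nn; have := vN n Nn.
by rewrite /= -ball_normE/= rnormE ltcR -rnormN opprB.
Qed.

(** * The real inner product *)

(** The discriminant inequality. It gives Cauchy-Schwarz (with e a squared norm)
    and, with e the defect of an almost minimizer, the approximate orthogonality
    used in the projection theorem. *)
Lemma quadratic_bound (R : realType) (a b e : R) : 0 <= b ->
  (forall t, 2 * t * a <= e + t ^+ 2 * b) -> a ^+ 2 <= e * b.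
Proof.
move=> b0 h; have [b00|bN0] := eqVneq b 0.
  rewrite b00 mulr0; have [->|aN0] := eqVneq a 0; first by rewrite expr0n.
  have := h ((e + 1) / (2 * a)); rewrite b00 mulr0 addr0.
  suff -> : 2 * ((e + 1) / (2 * a)) * a = e + 1 by lra.
  by field.
have bp : 0 < b by rewrite lt_def bN0.
have := h (a / b).
have -> : 2 * (a / b) * a = 2 * (a ^+ 2 / b) by field.
have -> : (a / b) ^+ 2 * b = a ^+ 2 / b by field.
by move=> hh; rewrite -ler_pdivrMr//; lra.
Qed.

Section real_inner_product.
Variables (R : realType) (H : completeNormedModType R[i]).
Variable dot : {dot H for @Num.conj R[i]}.
Hypothesis norm_dot : norm_induced_by dot.
Implicit Types (x y z : H) (a : R).

Definition rdot x y : R := complex.Re (dot x y).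

Lemma rdotDl x y z : rdot (x + y) z = rdot x z + rdot y z.
Proof. by rewrite /rdot linearDl /=; move: (dot x z) (dot y z) => [? ?] []. Qed.

Lemma rdotZl a x y : rdot (a%:C%C *: x) y = a * rdot x y.
Proof.
by rewrite /rdot linearZl_LR/=; case: (dot x y) => ? ?/=; rewrite mul0r subr0.
Qed.

Lemma rdotC x y : rdot x y = rdot y x.
Proof.
by rewrite /rdot hermC expr0 mul1r /=; move: (dot y x) => [].
Qed.

Lemma rdotDr x y z : rdot z (x + y) = rdot z x + rdot z y.
Proof. by rewrite ![rdot z _]rdotC rdotDl. Qed.

Lemma rdotZr a x y : rdot y (a%:C%C *: x) = a * rdot y x.
Proof. by rewrite ![rdot y _]rdotC rdotZl. Qed.

Lemma rdotNl x y : rdot (- x) y = - rdot x y.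
Proof. by rewrite /rdot linearNl /=; move: (dot x y) => []. Qed.

Lemma rdotNr x y : rdot y (- x) = - rdot y x.
Proof. by rewrite ![rdot y _]rdotC rdotNl. Qed.

Lemma rdot0r x : rdot x 0 = 0.
Proof. by rewrite /rdot linear0r. Qed.

Lemma rdotxx x : rdot x x = rnorm x ^+ 2.
Proof.
apply: complexI; rewrite rmorphXn/= -rnormE norm_dot sqrtCK /rdot RRe_real//.
by rewrite ger0_real// dnorm_ge0.
Qed.

Lemma rdot_Cauchy_Schwarz x y : `|rdot x y| <= rnorm x * rnorm y.
Proof.
have : rdot x y ^+ 2 <= rnorm x ^+ 2 * rnorm y ^+ 2.
  apply: quadratic_bound => [|t]; first exact: sqr_ge0.
  have := sqr_ge0 (rnorm (x + - (t%:C%C *: y))).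
  rewrite -(rdotxx (x - _)) !(rdotDl, rdotDr, rdotNl, rdotNr, rdotZl, rdotZr) !rdotxx.
  rewrite (rdotC y x); lra.
rewrite -exprMn -ler_sqrt ?sqr_ge0// !sqrtr_sqr [X in _ <= X]ger0_norm//.
by rewrite mulr_ge0 ?rnorm_ge0.
Qed.

Lemma rdot_ext x y : (forall z, rdot z x = rdot z y) -> x = y.
Proof.
move=> xy; apply/eqP; rewrite -subr_eq0; apply/eqP/rnorm_eq0.
by apply/eqP; rewrite -sqrf_eq0 -rdotxx rdotDr rdotNr xy subrr.
Qed.

(** * Orthogonal projection and Riesz representation *)

(** A sequence in V minimizing the distance to p is Cauchy by the parallelogram
    identity; its limit is q. Each p - v n is almost orthogonal to V: moving v n
    along a direction w of V cannot decrease the squared distance by more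
    than 1/(n+1), which bounds the inner product with w. V is a real
    subspace, so this covers kernels of real-linear functionals. *)
Lemma orthogonal_projection (V : set H) (p : H) : V 0 ->
  (forall x y, V x -> V y -> V (x + y)) ->
  (forall a x, V x -> V (a%:C%C *: x)) ->
  exists2 q, closure V q & forall v, V v -> rdot (p - q) v = 0.
Proof.
move=> V0 VD VZ.
pose D := [set rnorm (p - v) ^+ 2 | v in V].
have D0 : has_inf D.
  split; first by exists (rnorm (p - 0) ^+ 2); exists 0.
  by exists 0 => _ [v _ <-]; exact: sqr_ge0.
have infD v : V v -> inf D <= rnorm (p - v) ^+ 2.
  by move=> Vv; apply: ge_inf; [exact: D0.2|exists v].
have /choice[v vP] (n : nat) : exists v, V v /\ rnorm (p - v) ^+ 2 < inf D + n.+1%:R^-1.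
  have [_ [v Vv <-] ?] := @inf_adherent R D n.+1%:R^-1 (ltac:(by rewrite invr_gt0)) D0.
  by exists v.
have vV n := (vP n).1; have vd n := (vP n).2.
have inv_small e : 0 < e -> exists N, forall n, (N <= n)%N -> n.+1%:R^-1 < e :> R.
  move=> e0; have [N _ hN] := near_infty_natSinv_lt (PosNum e0).
  by exists N => n /hN.
(* Parallelogram identity at p - v m and p - v n, whose midpoint is p minus a
   point of V. *)
have close m n : rnorm (v m - v n) ^+ 2 <= 2 * (m.+1%:R^-1 + n.+1%:R^-1).
  have := infD _ (VZ (2^-1) _ (VD _ _ (vV m) (vV n))).
  move: (vd m) (vd n).
  rewrite -!rdotxx !(rdotDl, rdotDr, rdotNl, rdotNr, rdotZl, rdotZr).
  rewrite (rdotC (v m) p) (rdotC (v n) p) (rdotC (v n) (v m)).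
  move: (m.+1%:R^-1 : R) (n.+1%:R^-1 : R) => ? ?; lra.
have [|q vq] := @rnorm_complete _ _ v.
  move=> e e0; have [|N hN] := inv_small (e ^+ 2 / 4).
    by rewrite divr_gt0// exprn_gt0.
  exists N => m n Nm Nn; rewrite -(@ltr_pXn2r _ 2)// ?nnegrE ?rnorm_ge0 ?ltW//.
  apply: (le_lt_trans (close _ _)).
  by move: (hN _ Nm) (hN _ Nn); move: (m.+1%:R^-1 : R) (n.+1%:R^-1 : R) => ? ?; lra.
exists q.
  apply/closure_rnormP => e e0; have [N /(_ N (leqnn N)) hN] := vq e e0.
  by exists (v N) => //; rewrite -rnormN opprB.
move=> w Vw; apply/eqP; rewrite -normr_le0; apply/ler_addgt0Pr => e0 e0p.
have n1 : 0 < 2 * (rnorm w + 1) by rewrite mulr_gt0// ltr_wpDl ?rnorm_ge0.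
(* Two errors of size e |w| have to sum to less than e0. *)
pose e := e0 / (2 * (rnorm w + 1)); have ep : 0 < e by rewrite divr_gt0.
have [N hN] := inv_small (e ^+ 2) (ltac:(by rewrite exprn_gt0)).
have [N' hN'] := vq e ep; pose n := maxn N N'.
have {}hN := hN n (leq_maxl _ _); have {}hN' := hN' n (leq_maxr _ _).
have hw : rdot (p - v n) w ^+ 2 <= n.+1%:R^-1 * rnorm w ^+ 2.
  apply: quadratic_bound => [|t]; first exact: sqr_ge0.
  have := infD _ (VD _ _ (vV n) (VZ t _ Vw)).
  move: (vd n).
  rewrite -!rdotxx opprD addrA.
  rewrite !(rdotDl, rdotDr, rdotNl, rdotNr, rdotZl, rdotZr).
  rewrite (rdotC (v n) p) (rdotC w p) (rdotC w (v n)).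
  move: (n.+1%:R^-1 : R) => ?; lra.
have {}hw : `|rdot (p - v n) w| <= e * rnorm w.
  rewrite -(@ler_pXn2r _ 2)// ?nnegrE ?(mulr_ge0 (ltW ep) (rnorm_ge0 w))//.
  rewrite real_normK ?num_real// exprMn (le_trans hw)// ler_wpM2r ?sqr_ge0//.
  exact: ltW.
have -> : p - q = (p - v n) + (v n - q) by rewrite addrA subrK.
rewrite add0r rdotDl (le_trans (ler_normD _ _))//.
apply: (@le_trans _ _ (e * rnorm w + e * rnorm w)).
  rewrite lerD// (le_trans (rdot_Cauchy_Schwarz _ _))// ler_wpM2r ?rnorm_ge0//.
  exact: ltW.
have -> : e0 = e * (2 * (rnorm w + 1)) by rewrite /e divfK// gt_eqF.
by move: ep; nra.
Qed.

(** If f does not vanish, project a point outside the kernel onto the closure of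
    the kernel; the residue w is orthogonal to the kernel, and f is a multiple
    of the inner product with w. *)
Lemma Riesz_representation (f : H -> R) (C : R) :
  (forall x y, f (x + y) = f x + f y) ->
  (forall a x, f (a%:C%C *: x) = a * f x) ->
  (forall x, `|f x| <= C * rnorm x) ->
  exists y, forall z, f z = rdot z y.
Proof.
move=> fD fZ fC.
have [f0|/existsNP[p fp]] := pselect (forall x, f x = 0).
  by exists 0 => z; rewrite f0 rdot0r.
have f0 : f 0 = 0 by have := fZ 0 0; rewrite scaler0 mul0r.
have fN x : f (- x) = - f x.
  by apply/eqP; rewrite -addr_eq0 -fD addNr f0.
have [||q Kq pq] := @orthogonal_projection [set x | f x = 0] p f0.
- by move=> x y /= fx fy; rewrite fD fx fy addr0.
- by move=> a x /= fx; rewrite fZ fx mulr0.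
have fq : f q = 0.
  apply/eqP; rewrite -normr_le0; apply/ler_addgt0Pr => e e0; rewrite add0r.
  have C0 : 0 < `|C| + 1 by rewrite ltr_wpDl.
  have [v /= fv qv] := (closure_rnormP _ _).1 Kq (e / (`|C| + 1)) (divr_gt0 e0 C0).
  have -> : f q = f (q - v) by rewrite fD fN fv subr0.
  apply: (le_trans (fC _)); move: qv; rewrite ltr_pdivlMr// => qv.
  apply: le_trans (ltW qv); rewrite mulrC ler_wpM2l ?rnorm_ge0//.
  by rewrite (le_trans (ler_norm _))// lerDl.
pose w := p - q; have fw : f w != 0 by rewrite fD fN fq subr0; apply/eqP.
have w0 : rdot w w != 0.
  rewrite rdotxx sqrf_eq0; apply: contra fw => /eqP/rnorm_eq0 ->.
  by rewrite f0.
exists ((f w / rdot w w)%:C%C *: w) => z.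
have := pq (z - (f z / f w)%:C%C *: w).
rewrite /= fD fN fZ divfK// subrr => /(_ erefl).
rewrite rdotDr rdotNr !rdotZr rdotC => /eqP; rewrite subr_eq0 => /eqP ->.
by field; rewrite fw w0.
Qed.

End real_inner_product.

(** * Power-bounded operators and bounded sequences *)

Lemma iterZ (K : nzRingType) (V : lmodType K) (T : {linear V -> V}) n (a : K) (x : V) :
  iter n T (a *: x) = a *: iter n T x.
Proof. by elim: n => //= n ->; rewrite linearZ. Qed.

Lemma power_bounded_bound (R : realType) (H : normedModType R[i])
    (T : {linear H -> H}) : power_bounded T ->
  exists2 C : R, 0 <= C & forall n x, rnorm (iter n T x) <= C * rnorm x.
Proof.
rewrite /power_bounded; set s := ereal_sup _ => s_oo.
have s_ub n (x : H) : rnorm x <= 1 -> ((rnorm (iter n.+1 T x))%:E <= s)%E.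
  move=> x1; apply: (@le_trans _ _ (opnorm (iter n.+1 T))).
    by apply: ereal_sup_ubound; exists x.
  by apply: ereal_sup_ubound; exists n.+1.
have [M M0 uM] : exists2 M : R, 0 <= M &
    forall n (x : H), rnorm x <= 1 -> rnorm (iter n T x) <= M.
  (* The 1 accounts for the power 0, which the supremum leaves out. *)
  exists (Num.max 1 (fine s)); first by rewrite le_max ler01.
  move=> [|n] x x1; rewrite le_max ?x1//; apply/orP; right.
  rewrite -lee_fin fineK ?s_ub// fin_numE (lt_eqF s_oo) andbT.
  apply/eqP => s_Noo; have := s_ub n x x1.
  by rewrite s_Noo leeNy_eq.
exists M => // n x.
have [x0|x0] := eqVneq (rnorm x) 0.
  rewrite x0 mulr0 (rnorm_eq0 x0) -(scale0r (0 : H)) iterZ scale0r.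
  by rewrite /rnorm normr0.
have xp : 0 < rnorm x by rewrite lt_def x0 rnorm_ge0.
have := uM n ((rnorm x)^-1%:C%C *: x).
rewrite iterZ !rnormZ ger0_norm ?invr_ge0 ?rnorm_ge0// mulVf// => /(_ (lexx 1)).
by rewrite ler_pdivrMl// mulrC.
Qed.

Lemma bounded_fun_rnormP (R : realType) (H : normedModType R[i]) (u : nat -> H) :
  bounded_fun u <-> exists M : R, forall n, rnorm (u n) <= M.
Proof.
split.
- move=> /(@ex_bound _ _ _ _ _ (globally_properfilter (a := 0%N) I))[M uM].
  exists (complex.Re M) => n; have := uM n I.
  by rewrite /= lecE => /andP[].
- move=> [M uM]; apply/(@ex_bound _ _ _ _ _ (globally_properfilter (a := 0%N) I)).
  by exists (M%:C)%C => n _ /=; rewrite rnormE lecR.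
Qed.

(** * The asymptotic limit of a power-bounded operator *)

Section power_bounded_operator.
Variables (R : realType) (H : completeNormedModType R[i]).
Variable dot : {dot H for @Num.conj R[i]}.
Hypothesis norm_dot : norm_induced_by dot.
Variables (T : {linear H -> H}) (C : R).
Hypothesis C0 : 0 <= C.
Hypothesis TC : forall n x, rnorm (iter n T x) <= C * rnorm x.
Local Notation "<< x , y >>" := (rdot dot x y).
Local Notation S := (adjoint dot T).

(** The real Riesz theorem provides a candidate z with the same real part of the
    inner product; replacing y by 'i y shows that the imaginary parts agree as
    well, so z is the adjoint vector. *)
Lemma rdot_adjoint x y : <<T y, x>> = <<y, S x>>.
Proof.
rewrite /adjoint.
have [||y'|z zP] := Riesz_representation (f := fun y => <<T y, x>>)
    (C := C * rnorm x) norm_dot.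
- by move=> ? ?; rewrite raddfD rdotDl.
- by move=> ? ?; rewrite linearZ rdotZl.
- rewrite mulrAC; apply: (le_trans (rdot_Cauchy_Schwarz norm_dot _ _)).
  by rewrite ler_wpM2r ?rnorm_ge0//; exact: (TC 1 y').
case: xgetP => [_ -> hz|/(_ z)]; first by rewrite /rdot hz.
case=> y' /=.
have := zP ('i%C *: y'); have := zP y'.
rewrite linearZ /rdot !linearZl_LR/=.
move: (dot (T y') x) (dot y' z) => [a b] [a' b']/= -> /eqP.
by rewrite !mul0r !mul1r !add0r eqr_opp => /eqP ->.
Qed.

Lemma rdot_iter_adjoint n x y : <<iter n T y, x>> = <<y, iter n S x>>.
Proof. by elim: n y => //= n IHn y; rewrite -rdot_adjoint -IHn -iterSr. Qed.

(** |S^n x|^2 = <T^n S^n x, x> <= C |S^n x| |x|. *)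
Lemma rnorm_iter_adjoint n x : rnorm (iter n S x) <= C * rnorm x.
Proof.
have [->|x0] := eqVneq (rnorm (iter n S x)) 0.
  by rewrite mulr_ge0 ?rnorm_ge0.
rewrite -(@ler_pM2r _ (rnorm (iter n S x))); last by rewrite lt_def x0 rnorm_ge0.
rewrite -expr2 -(rdotxx norm_dot) -rdot_iter_adjoint.
apply: (le_trans (ler_norm _)); apply: (le_trans (rdot_Cauchy_Schwarz norm_dot _ _)).
by rewrite mulrAC ler_wpM2r ?rnorm_ge0.
Qed.

Lemma rdot_orbit_le n x z :
  `|<<z, iter n T (iter n S x)>>| <= C * (C * rnorm x) * rnorm z.
Proof.
apply: (le_trans (rdot_Cauchy_Schwarz norm_dot _ _)).
rewrite mulrC ler_wpM2r ?rnorm_ge0// (le_trans (TC _ _))// ler_wpM2l//.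
exact: rnorm_iter_adjoint.
Qed.

Lemma bounded_orbit x z : bounded_seq (fun n => <<z, iter n T (iter n S x)>>).
Proof. by exists (C * (C * rnorm x) * rnorm z) => n; exact: rdot_orbit_le. Qed.

(** <S^n z, S^n x> is written <z, T^n S^n x>, which is linear in z for the sole
    reason that the inner product is; power-boundedness of T, and hence of S,
    bounds it by C^2 |x| |z|, so the Riesz theorem applies for each x. *)
Lemma asymptotic_limit_exists (L : (nat -> R) -> R) : banach_limit L ->
  exists Q : H -> H, forall x z,
    <<z, Q x>> = L (fun n => <<z, iter n T (iter n S x)>>).
Proof.
move=> HL.
suff Qx x : exists y, forall z,
    <<z, y>> = L (fun n => <<z, iter n T (iter n S x)>>).
  by have [Q QP] := choice Qx; exists Q.
have [||z|y yP] := @Riesz_representation _ _ _ norm_dot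
  (fun z => L (fun n => <<z, iter n T (iter n S x)>>)) (C * (C * rnorm x)).
- move=> y z; rewrite -(blimD HL); [|exact: bounded_orbit..].
  by congr L; apply/funext => n; rewrite rdotDl.
- move=> a z; rewrite -(blimZ HL); last exact: bounded_orbit.
  by congr L; apply/funext => n; rewrite rdotZl.
- by apply: (blim_norm_le HL) => n; exact: rdot_orbit_le.
by exists y => z; rewrite -yP.
Qed.

(** The backward orbit is k |-> Q (S^k x): testing T Q S y = Q y against z moves T
    to the other side, and <S z, T^n S^n S y> is the term of index n+1 of the
    sequence defining <z, Q y>. *)
Lemma asymptotic_limit_backward (L : (nat -> R) -> R) (Q : H -> H) :
  banach_limit L ->
  (forall x z, <<z, Q x>> = L (fun n => <<z, iter n T (iter n S x)>>)) ->
  forall x, bounded_backward_set T (Q x).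
Proof.
move=> HL QP x; exists (fun k => Q (iter k S x)); split => //.
- apply/bounded_fun_rnormP; exists (C * (C * (C * rnorm x))) => k.
  set y := iter k S x.
  apply: (@le_trans _ _ (C * (C * rnorm y))).
    have [->|Qy0] := eqVneq (rnorm (Q y)) 0.
      by rewrite !mulr_ge0 ?rnorm_ge0.
    rewrite -(@ler_pM2r _ (rnorm (Q y))); last by rewrite lt_def Qy0 rnorm_ge0.
    rewrite -expr2 -(rdotxx norm_dot) QP (le_trans (ler_norm _))//.
    by apply: (blim_norm_le HL) => n; exact: rdot_orbit_le.
  by rewrite !ler_wpM2l//; exact: rnorm_iter_adjoint.
- move=> k; apply: (rdot_ext norm_dot) => z.
  rewrite rdotC rdot_adjoint rdotC !QP -[RHS](blim_shift HL).
    congr L; apply/funext => n; rewrite rdotC -rdot_adjoint rdotC.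
    by rewrite [iter n.+1 S _]iterSr.
  exact: bounded_orbit.
Qed.

(** <y, x> = <T^n (u n), x> = <u n, S^n x> for a bounded backward orbit u of
    y. *)
Lemma backward_set_rdot_small x y e : bounded_backward_set T y ->
  (forall e : R, 0 < e -> exists n, rnorm (iter n S x) < e) ->
  0 < e -> `|<<y, x>>| <= e.
Proof.
move=> [u [/bounded_fun_rnormP[M uM] <- Tu]] Sx e0.
have M0 : 0 < `|M| + 1 by rewrite ltr_wpDl.
have [n Sn] := Sx (e / (`|M| + 1)) (divr_gt0 e0 M0).
have -> : u 0%N = iter n T (u n).
  by elim: n {Sn} => // n IHn; rewrite iterSr Tu.
rewrite rdot_iter_adjoint (le_trans (rdot_Cauchy_Schwarz norm_dot _ _))//.
move: Sn; rewrite ltr_pdivlMr// => /ltW; apply: le_trans.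
rewrite mulrC ler_wpM2l ?rnorm_ge0// (le_trans (uM n))//.
by rewrite (le_trans (ler_norm _))// lerDl.
Qed.

(** A nonzero x would be orthogonal to Q x, whereas <x, Q x> = L(|S^n x|^2) is at
    least c^2 when |S^n x| >= c for all large n. *)
Lemma orthogonal_backward_set_eq0 x : class_C_1 dot T ->
  (forall y, bounded_backward_set T y -> <<x, y>> = 0) -> x = 0.
Proof.
move=> TC1 xM; apply: contrapT => /eqP x0.
have /limn_einf_gt0P[c [N [c0 cS]]] := TC1 x x0.
have [L HL] := banach_limit_exists R.
have [Q QP] := asymptotic_limit_exists HL.
have := xM _ (asymptotic_limit_backward HL QP x).
pose u n := <<x, iter n T (iter n S x)>>.
have uE n : u n = rnorm (iter n S x) ^+ 2.
  by rewrite /u rdotC rdot_iter_adjoint (rdotxx norm_dot).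
have bu : bounded_seq u by exact: bounded_orbit.
have bshift k : bounded_seq (fun n => u (k + n)%N).
  by have [B uB] := bu; exists B => n; exact: uB.
(* The lower bound holds only from N on; L does not see the first N terms. *)
have Lshift k : L (fun n => u (k + n)%N) = L u.
  elim: k => [//|k <-]; rewrite -(blim_shift HL (bshift k)).
  by congr L; apply/funext => n; rewrite addnS.
rewrite QP -/u -(Lshift N) => Lu0.
suff : c ^+ 2 <= 0 by rewrite leNgt exprn_gt0.
rewrite -Lu0; apply: (blim_ge HL) => // n.
by rewrite uE lerXn2r ?nnegrE ?rnorm_ge0 ?(ltW c0)// cS ?leq_addr.
Qed.

Lemma dense_backward_set : class_C_1 dot T ->
  closure (bounded_backward_set T) = [set: H].
Proof.
move=> TC1; apply/seteqP; split => // p _.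
have [||| q Mq pq] := @orthogonal_projection _ _ _ norm_dot
    (bounded_backward_set T) p.
- exists (fun=> 0); split => //; last by move=> _; rewrite raddf0.
  by apply/bounded_fun_rnormP; exists 0 => n; rewrite /rnorm normr0.
- move=> _ _ [u [/bounded_fun_rnormP[M uM] <- Tu]] [v [/bounded_fun_rnormP[M' vM] <- Tv]].
  exists (fun n => u n + v n); split => // [|n]; last by rewrite linearD Tu Tv.
  apply/bounded_fun_rnormP; exists (M + M') => n.
  by rewrite (le_trans (ler_rnormD _ _))// lerD.
- move=> a _ [u [/bounded_fun_rnormP[M uM] <- Tu]].
  exists (fun n => a%:C%C *: u n); split => // [|n]; last by rewrite linearZ Tu.
  apply/bounded_fun_rnormP; exists (`|a| * M) => n.
  by rewrite rnormZ ler_wpM2l.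
suff /eqP : p - q = 0 by rewrite subr_eq0 => /eqP ->.
exact: orthogonal_backward_set_eq0.
Qed.

Lemma class_C_1_of_dense :
  closure (bounded_backward_set T) = [set: H] -> class_C_1 dot T.
Proof.
move=> MT x x0; apply/limn_einf_gt0P; apply: contrapT => nSx.
have Sx e : 0 < e -> exists n, rnorm (iter n S x) < e.
  move=> e0; apply: contrapT => /forallNP h; apply: nSx; exists e, 0%N.
  by split=> // n _; rewrite leNgt; apply/negP/h.
have Mx y : bounded_backward_set T y -> <<y, x>> = 0.
  move=> My; apply/eqP; rewrite -normr_le0; apply/ler_addgt0Pr => e e0.
  by rewrite add0r; exact: backward_set_rdot_small.
move: x0 => /eqP; apply; apply: rnorm_eq0; apply/eqP; rewrite -normr_le0.
rewrite ger0_norm ?rnorm_ge0//; apply/ler_addgt0Pr => e e0; rewrite add0r.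
have Vx : closure (bounded_backward_set T) x by rewrite MT.
have [y /Mx yx xy] := (closure_rnormP _ _).1 Vx e e0.
have [->|nx0] := eqVneq (rnorm x) 0; first exact: ltW.
have nxp : 0 < rnorm x by rewrite lt_def nx0 rnorm_ge0.
rewrite -(ler_pM2r nxp) -expr2 -(rdotxx norm_dot).
rewrite -{1}(subrK y x) rdotDl yx addr0.
rewrite (le_trans (ler_norm _))// (le_trans (rdot_Cauchy_Schwarz norm_dot _ _))//.
by rewrite ler_wpM2r ?rnorm_ge0 ?(ltW xy).
Qed.

End power_bounded_operator.

Theorem theorem3p3 (R : realType) (H : completeNormedModType R[i])
    (dot : {dot H for @Num.conj R[i]}) (norm_dot : norm_induced_by dot)
    (H_separable : separable H)
    (T : {linear H -> H}) (T_bounded : bounded_near T (nbhs (0 : H)))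
    (T_power_bounded : power_bounded T) :
  class_C_1 dot T <-> closure (bounded_backward_set T) = [set: H].
Proof.
have [C C0 TC] := power_bounded_bound T_power_bounded.
split; first exact: (dense_backward_set norm_dot C0 TC).
exact: (class_C_1_of_dense norm_dot TC).
Qed.
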